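(* For all positive integers $s,t$, if a finite graph $G$ does not contain $K^*_{s,t}$ as a minor, then $\mathrm{box}(G)\le 5s^3(t-1)$.
   Context: Graphs are finite and simple. $K^*_{s,t}$ denotes the complete join of $K_s$ and an independent set of $t$ vertices (i.e., $s+t$ vertices, the $s$ vertices forming a clique and each adjacent to all $t$ others, the $t$ vertices pairwise non-adjacent). The boxicity $\mathrm{box}(G)$ is the smallest $k$ such that $G$ is the intersection (same vertex set, intersection of edge sets) of $k$ interval graphs.
   Formalization: The formal theorem assumes t ≥ 2 instead of t ≥ 1: at t = 1 the bound is 0 and the claim fails for every s, since two isolated vertices contain no K_{s+1} = K*_{s,1} minor but have boxicity 1. *)

(* Defs.v *)
From mathcomp Require Import all_boot all_order all_algebra.
From mathcomp Require Import boolp reals.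

Set Implicit Arguments.
Unset Strict Implicit.
Unset Printing Implicit Defensive.

Import Order.TTheory GRing.Theory Num.Theory.

Record sgraph (T : finType) := SGraph {
  adj :> rel T;
  adj_sym : symmetric adj;
  adj_irr : irreflexive adj }.

(* [A] induces a connected subgraph; the empty set is connected in this sense,
   so nonemptiness is required separately in [minor]. *)
Definition connected_in (T : finType) (G : sgraph T) (A : {set T}) : Prop :=
  forall x y : T, x \in A -> y \in A ->
    connect [rel u v | [&& u \in A, v \in A & G u v]] x y.

(* [H] is obtained from a subgraph of [G] by contracting the pairwise disjoint
   connected branch sets [B u] to single vertices. *)
Definition minor (S T : finType) (H : sgraph S) (G : sgraph T) : Prop :=
  exists B : S -> {set T},
    [/\ forall u, B u != set0,
        forall u, connected_in G (B u),
        forall u v, u != v -> [disjoint B u & B v]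
      & forall u v, H u v -> exists x y, [/\ x \in B u, y \in B v & G x y]].

Section CompleteJoin.
Variables s t : nat.

Definition Kstar_adj : rel ('I_s + 'I_t) := fun x y =>
  match x, y with
  | inl i, inl j => i != j
  | inr _, inr _ => false
  | _, _ => true
  end.

Lemma Kstar_sym : symmetric Kstar_adj.
Proof. by case=> i [] j //=; rewrite eq_sym. Qed.

Lemma Kstar_irr : irreflexive Kstar_adj.
Proof. by case=> i //=; rewrite eqxx. Qed.

(* [Kstar s 1] is the complete graph on [s.+1] vertices. No bound on boxicity
   of the form [c * (t - 1)] holds at [t = 1]: the graph with two vertices and
   no edge has no [Kstar s 1] minor for [0 < s] and has boxicity 1. *)
Definition Kstar : sgraph ('I_s + 'I_t)%type := SGraph Kstar_sym Kstar_irr.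

End CompleteJoin.

Definition interval_graph (R : realType) (T : finType) (G : sgraph T) : Prop :=
  exists l r : T -> R,
    (forall u, (l u <= r u)%R) /\
    (forall u v, u != v ->
       (G u v <-> exists x : R, x \in `[l u, r u]%R /\ x \in `[l v, r v]%R)).

(* The condition [u != v] makes the empty intersection ([k = 0]) the complete
   graph on [T]; thus complete graphs have boxicity 0. *)
Definition interval_intersection (R : realType) (T : finType) (G : sgraph T)
    (k : nat) : Prop :=
  exists H : 'I_k -> sgraph T,
    (forall i, interval_graph R (H i)) /\
    (forall u v, u != v -> (G u v <-> forall i, H i u v)).

(* The graph [star_fill G w] is obtained from [G] by adding all edges not
   incident with [w]. *)
Section StarFill.
Variables (T : finType) (G : sgraph T) (w : T).

Definition star_fill_adj : rel T := fun x y =>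
  [&& x != y, (x == w) ==> G x y & (y == w) ==> G x y].

Lemma star_fill_sym : symmetric star_fill_adj.
Proof.
move=> x y; rewrite /star_fill_adj eq_sym (adj_sym G y x).
by congr (_ && _); rewrite andbC.
Qed.

Lemma star_fill_irr : irreflexive star_fill_adj.
Proof. by move=> x; rewrite /star_fill_adj eqxx. Qed.

Definition star_fill : sgraph T := SGraph star_fill_sym star_fill_irr.

Lemma star_fill_interval (R : realType) : interval_graph R star_fill.
Proof.
exists (fun x => if (x == w) || G w x then 0 else 1)%R.
exists (fun x => if x == w then 0 else 1)%R; split.
  by move=> u; case: (u == w) => //=; case: (G w u).
move=> u v uv; rewrite /= /star_fill_adj uv /=.
case: (eqVneq u w) => [uw|uw]; case: (eqVneq v w) => [vw|vw] /=.
- by move: uv; rewrite uw vw eqxx.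
- rewrite uw andbT; split=> [->|[x []]].
    by exists 0%R; rewrite !in_itv /= !lexx ler01.
  rewrite !in_itv /= => /andP[_ x0]; case: (G w v) => // /andP[x1 _].
  by have := le_trans x1 x0; rewrite ler10.
- rewrite vw (adj_sym G u w); split=> [->|[x []]].
    by exists 0%R; rewrite !in_itv /= !lexx ler01.
  rewrite !in_itv /= => + /andP[_ x0]; case: (G w u) => // /andP[x1 _].
  by have := le_trans x1 x0; rewrite ler10.
- split=> // _; exists 1%R; rewrite !in_itv /= !lexx.
  by case: (G w u); case: (G w v); rewrite ?lexx ?ler01.
Qed.

End StarFill.

Lemma interval_intersection_exists (R : realType) (T : finType) (G : sgraph T) :
  exists k, `[< interval_intersection R G k >].
Proof.
exists #|T|; apply/asboolP; exists (fun i => star_fill G (enum_val i)); split.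
  by move=> i; exact: star_fill_interval.
move=> u v uv; split=> [Guv i|/(_ (enum_rank u))].
  by rewrite /= /star_fill_adj uv Guv !implybT.
by rewrite /= enum_rankK /star_fill_adj eqxx /= => /and3P[].
Qed.

Definition boxicity (R : realType) (T : finType) (G : sgraph T) : nat :=
  ex_minn (interval_intersection_exists R G).

(* Main.v *)
(** Decompose G recursively into connected clusters coloured with s+1 colours:
    inside the current component U, at most s of the earlier clusters touching
    U are kept, they pairwise touch, and the next cluster H gets a free colour.
    H is grown in stages: each stage adds the union of s+1 root paths of a
    breadth-first tree of a component D of U \ H, so as to touch H and all the
    kept clusters.  The stages are disjoint connected sets, so more than t-1 of
    them, together with s kept clusters, would form a K*_{s,t} minor; when no
    further stage is possible, every component of U \ H misses one of the s
    clusters, and the recursion goes on.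

    Vertices are classified by the colour of their cluster, the index of their
    path in it and the parity of their breadth-first level.  A vertex v has all
    its neighbours on one such path within three consecutive levels, so a
    non-neighbour u of v in the class lies before all neighbours of v in that
    class, or after them; ordering each class by depth of the clusters, and
    then by level or by reversed level, gives two interval graphs per class.
    They separate all non-adjacent pairs whose clusters are comparable in the
    recursion tree; one more interval graph separates the incomparable ones.
    In total box(G) <= 4 (s+1)^2 (t-1) + 1, which suffices for s >= 2.

    For s = 1 the breadth-first levels of a component have at most t-1
    vertices, so a whole component serves as one cluster, the path index being
    replaced by the index in the level, and box(G) <= 4 (t-1) + 1. *)

Require Import Defs.
From mathcomp Require Import all_boot all_order all_algebra.
From mathcomp Require Import boolp reals.
From mathcomp Require Import zify.

Import Order.TTheory Num.Theory.

Set Implicit Arguments.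
Unset Strict Implicit.
Unset Printing Implicit Defensive.

(** * Interval graphs with natural endpoints, and a boxicity bound from ordered vertex classes *)

Section NatIntervals.
Variables (R : realType) (T : finType).

Section Def.
Variables l r : T -> nat.

Definition overlap (u v : T) : bool := (l u <= r v) && (l v <= r u).

Lemma overlapC u v : overlap u v = overlap v u.
Proof. exact: andbC. Qed.

Definition nat_interval_adj : rel T := fun u v => (u != v) && overlap u v.

Lemma nat_interval_sym : symmetric nat_interval_adj.
Proof. by move=> u v; rewrite /nat_interval_adj eq_sym overlapC. Qed.

Lemma nat_interval_irr : irreflexive nat_interval_adj.
Proof. by move=> u; rewrite /nat_interval_adj eqxx. Qed.

Definition nat_interval : sgraph T := SGraph nat_interval_sym nat_interval_irr.

Lemma nat_intervalP : (forall u, l u <= r u) -> interval_graph R nat_interval.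
Proof.
move=> lr; exists (fun u => (l u)%:R)%R, (fun u => (r u)%:R)%R; split.
  by move=> u; rewrite ler_nat.
move=> u v uv; rewrite /= /nat_interval_adj uv /= /overlap; split.
  case/andP=> luv lvu; exists (maxn (l u) (l v))%:R%R.
  by rewrite !in_itv /= !ler_nat leq_maxl leq_maxr !geq_max lr lvu luv lr.
case=> x []; rewrite !in_itv /= => /andP[ux xu] /andP[vx xv].
by rewrite -!(ler_nat R) (le_trans ux) //
  (le_trans vx).
Qed.

End Def.

Variable G : sgraph T.

Lemma boxicity_le (K : finType) (H : K -> sgraph T) :
    (forall k, interval_graph R (H k)) ->
    (forall u v, u != v -> G u v <-> forall k, H k u v) ->
  boxicity R G <= #|K|.
Proof.
move=> HI HG; rewrite /boxicity; case: ex_minnP => k _; apply.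
apply/asboolP; exists (fun i => H (enum_val i)); split=> // u v uv.
split=> [Guv i|HH]; first exact: (HG _ _ uv).1.
by apply/(HG _ _ uv) => k'; rewrite -(enum_rankK k'); exact: HH.
Qed.

Section Classes.
Variables (I : finType) (cls : T -> I) (q : bool -> T -> nat) (l r : T -> nat).

(** With [U = setT] and [v] outside the class of [u], one of the two interval graphs of that class
    omits the pair. *)
Definition separated (U : {set T}) (u v : T) : Prop :=
  exists b, forall w, w \in U -> G v w -> cls w = cls u -> q b u < q b w.

(* In the graph of the class [i] and the order [q b], the members of [i] are
   points and every other vertex starts at its first neighbour in [i] and
   extends to the right end, so that all those vertices meet there. *)
Lemma boxicity_classes :
    (forall u, l u <= r u) ->
    (forall u v, G u v -> cls u <> cls v /\ overlap l r u v) ->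
    (forall u v, u != v -> ~~ G u v -> overlap l r u v ->
       cls u = cls v -> q true u <> q true v) ->
    (forall u v, u != v -> ~~ G u v -> overlap l r u v ->
       separated setT u v \/ separated setT v u) ->
  boxicity R G <= (#|I| * 2).+1.
Proof.
move=> lr adj_cls cls_inj sep.
pose N b := (\max_u q b u).+1.
have ltN b u : q b u < N b by rewrite ltnS; exact: leq_bigmax.
(* The default [N b] exceeds all values of [q b], so an outside vertex without neighbours in the
   class becomes a point at the right end. *)
pose first b i v := \big[Order.min/N b]_(w | G v w && (cls w == i)) q b w.
have firstN b i v : first b i v <= N b.
  by rewrite -leEnat; apply: bigmin_le_id.
have first_le b i v w : G v w -> cls w = i -> first b i v <= q b w.
  by move=> Gvw cw; rewrite -leEnat; apply: bigmin_le_cond; rewrite Gvw cw /=.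
pose lo b i v := if cls v == i then q b v else first b i v.
pose hi b i v := if cls v == i then q b v else N b.
pose H (k : option (I * bool)) :=
  if k is Some (i, b) then nat_interval (lo b i) (hi b i) else nat_interval l r.
have -> : (#|I| * 2).+1 = #|{: option (I * bool)}|.
  by rewrite card_option card_prod card_bool.
have sepH u v : u != v -> separated setT u v -> cls u <> cls v ->
    ~ forall k, H k u v.
  move=> uv [b sb] /eqP cuv /(_ (Some (cls u, b))) /=.
  rewrite /nat_interval_adj uv /= /overlap /lo /hi eqxx eq_sym (negPf cuv).
  case/andP=> _; apply/negP; rewrite -ltnNge.
  by rewrite -leEnat; apply: le_bigmin => // w /andP[Gvw /eqP cw]; exact: sb.
apply: (boxicity_le (H := H)) => [[[i b]|]|u v uv].
- apply: nat_intervalP => u; rewrite /lo /hi; case: eqP => // _.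
- exact: nat_intervalP.
- split=> [Guv [[i b]|]|HH].
  + have [/eqP cuv _] := adj_cls _ _ Guv.
    rewrite /= /nat_interval_adj uv /= /overlap /lo /hi.
    case: (eqVneq (cls u) i) => ui; case: (eqVneq (cls v) i) => vi //.
    * by rewrite ui vi eqxx in cuv.
    * by rewrite ltnW //= first_le // (adj_sym G).
    * by rewrite first_le //= ltnW.
    * by rewrite !firstN.
  + by rewrite /= /nat_interval_adj uv; case: (adj_cls _ _ Guv).
- apply: contraT => nG.
  have ov : overlap l r u v by have /andP[] := HH None.
  case: (eqVneq (cls u) (cls v)) => [cuv|/eqP cuv].
    have := HH (Some (cls u, true)).
    rewrite /= /nat_interval_adj uv /= /overlap /lo /hi eqxx -cuv eqxx => /andP[].
    move=> le1 le2; have /(_ (anti_leq _)) := cls_inj _ _ uv nG ov cuv.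
    by rewrite le1 le2 => /(_ isT).
  case: (sep _ _ uv nG ov) => S.
    by case: (sepH _ _ uv S cuv).
  rewrite eq_sym in uv; case: (sepH _ _ uv S (fun e => cuv (esym e))) => k.
  by have := HH k; rewrite (adj_sym (H k)).
Qed.

End Classes.
End NatIntervals.

(** * Connected sets, touching sets and breadth-first search *)

Section Connectivity.
Variables (T : finType) (G : sgraph T).
Implicit Types A B D H U : {set T}.

Definition induced A : rel T := fun u v => [&& u \in A, v \in A & G u v].
Arguments induced A u v /.

Lemma induced_connect_sym A : connect_sym (induced A).
Proof.
by apply: sym_connect_sym => u v /=; rewrite (adj_sym G); case: (u \in A); case: (v \in A).
Qed.

Lemma induced_connectS A B : A \subset B ->
  subrel (connect (induced A)) (connect (induced B)).
Proof.
move=> /subsetP AB; apply: connect_sub => u v /and3P[uA vA Guv].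
by apply: connect1; rewrite /= !AB.
Qed.

Lemma connected_center A x :
  (forall y, y \in A -> connect (induced A) x y) -> connected_in G A.
Proof.
move=> cx y z yA zA; apply: connect_trans (cx z zA).
by rewrite -/(induced A) induced_connect_sym cx.
Qed.

Lemma connected0 : connected_in G set0.
Proof. by move=> x y; rewrite inE. Qed.

Lemma connected1 x : connected_in G [set x].
Proof. by move=> y z /set1P-> /set1P->; exact: connect0. Qed.

Lemma connected_bigcup (I : finType) (Q : I -> {set T}) x :
    (forall i, connected_in G (Q i)) -> (forall i, x \in Q i) ->
  connected_in G (\bigcup_i Q i).
Proof.
move=> cQ xQ; apply: (@connected_center _ x) => y /bigcupP[i _ yi].
by apply: (induced_connectS (bigcup_sup i isT)); exact: cQ.
Qed.

Definition touch A B : bool := [exists x in A, [exists y in B, G x y]].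

Lemma touchP A B :
  reflect (exists x y, [/\ x \in A, y \in B & G x y]) (touch A B).
Proof.
apply: (iffP exists_inP) => [[x xA /exists_inP[y yB Gxy]]|[x [y [xA yB Gxy]]]].
  by exists x, y.
by exists x => //; apply/exists_inP; exists y.
Qed.

Lemma touchC A B : touch A B = touch B A.
Proof.
by apply/touchP/touchP => -[x [y [? ? ?]]]; exists y, x; split=> //; rewrite (adj_sym G).
Qed.

Lemma touchS A B B' : B \subset B' -> touch A B -> touch A B'.
Proof.
by move=> /subsetP BB /touchP[x [y [? /BB ? ?]]]; apply/touchP; exists x, y.
Qed.

Lemma touch_neq0 A B : touch A B -> B != set0.
Proof. by case/touchP=> x [y [_ yB _]]; apply/set0Pn; exists y. Qed.

Lemma connectedU A B :
  connected_in G A -> connected_in G B -> touch A B -> connected_in G (A :|: B).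
Proof.
move=> cA cB /touchP[x [y [xA yB Gxy]]]; apply: (@connected_center _ x) => z.
case/setUP=> [zA|zB].
  by apply: (induced_connectS (subsetUl A B)); exact: cA.
apply: (@connect_trans _ _ y).
  by apply: connect1; rewrite /= !inE xA yB orbT.
by apply: (induced_connectS (subsetUr A B)); exact: cB.
Qed.

Lemma component U x : x \in U -> exists D : {set T},
  [/\ D \subset U, x \in D, connected_in G D
    & forall Y : {set T}, Y \subset U -> connected_in G Y -> x \in Y -> Y \subset D]
  /\ (forall y z, y \in D -> z \in U -> G y z -> z \in D).
Proof.
move=> xU; pose D := [set y in U | connect (induced U) x y].
exists D.
have clD y z : y \in D -> z \in U -> G y z -> z \in D.
  rewrite !inE => /andP[yU xy] zU Gyz; rewrite zU (connect_trans xy) //.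
  by apply: connect1; rewrite /= yU zU.
split=> //; split.
- by apply/subsetP => y; rewrite inE => /andP[].
- by rewrite inE xU connect0.
- apply: (@connected_center _ x) => y; rewrite inE => /andP[yU /connectP[p]].
  have: x \in D by rewrite inE xU connect0.
  (* By closure the path never leaves [D], so it connects inside [D] and not only inside [U]. *)
  elim: p {1 2 3 4}x => [|z p IH] a aD /=; first by move=> _ ->; exact: connect0.
  case/andP=> /and3P[_ zU Gaz] pz lz.
  have zD := clD _ _ aD zU Gaz.
  apply: (@connect_trans _ _ z); last exact: IH.
  by apply: connect1; rewrite /= aD zD.
- move=> Y YU cY xY; apply/subsetP => y yY; rewrite inE (subsetP YU) //=.
  by apply: (induced_connectS YU); exact: cY.
Qed.

Lemma connected_leave U D x y : connected_in G U -> D \subset U ->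
  x \in D -> y \in U -> y \notin D ->
  exists d z, [/\ d \in D, z \in U, z \notin D & G d z].
Proof.
move=> cU DU xD yU; apply: contraNP => nex.
have cl : closed (induced U) D.
  apply: (intro_closed (induced_connect_sym U)) => u v /and3P[uU vU Guv] uD.
  by apply: contraT => vD; case: nex; exists u, v.
by rewrite -(closed_connect cl (cU x y (subsetP DU x xD) yU)).
Qed.

(** On [D], [lev] is the distance from [rho] inside [D]: the index of the first ball containing the
    vertex. *)
Lemma bfs D rho : connected_in G D -> rho \in D -> exists lev : T -> nat,
  [/\ lev rho = 0,
      forall u v, u \in D -> v \in D -> G u v -> lev v <= (lev u).+1
    & forall v, v \in D -> v = rho \/
        exists u, [/\ u \in D, G u v & lev v = (lev u).+1]].
Proof.
move=> cD rD.
pose fix ball n := if n is m.+1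
  then ball m :|: [set v in D | [exists u in ball m, G u v]] else [set rho].
have ballD n : ball n \subset D.
  elim: n => [|n IH] /=; first by rewrite sub1set.
  by rewrite subUset IH; apply/subsetP => v; rewrite inE => /andP[].
have reach v : v \in D -> exists n, v \in ball n.
  move=> vD; have /connectP[p] := cD rho v rD vD.
  have: rho \in ball 0 by rewrite /= inE.
  move: 0 => n; move: (rho) n.
  elim: p => [|z p IH] x n xn /=; first by move=> _ ->; exists n.
  case/andP=> /and3P[xU zU Gxz]; apply: (IH _ n.+1).
  by rewrite /= !inE zU; apply/orP; right; apply/exists_inP; exists x.
have /choice[lev levP] v : exists n, v \in D ->
    v \in ball n /\ forall m, v \in ball m -> n <= m.
  have [vD|] := boolP (v \in D); last by exists 0.
  by case: (ex_minnP (reach v vD)) => n vn min; exists n.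
exists lev; split=> [|u v uD vD Guv|v vD].
  by apply/eqP; rewrite -leqn0; apply: (levP rho rD).2; rewrite /= inE.
  apply: (levP v vD).2; rewrite /= !inE vD; apply/orP; right.
  by apply/exists_inP; exists u => //; exact: (levP u uD).1.
have [] := levP v vD; case E: (lev v) => [|n] /=.
  by rewrite inE => /eqP ->; left.
rewrite !inE => /orP[vn min|/andP[_ /exists_inP[u un Guv]] min].
  by have := min _ vn; rewrite ltnn.
right; exists u; have uD := subsetP (ballD n) u un; split=> //.
apply/eqP; rewrite eqSS eqn_leq (levP u uD).2 // andbT.
rewrite -ltnS; apply: min; rewrite /= !inE vD; apply/orP; right.
by apply/exists_inP; exists u => //; exact: (levP u uD).1.
Qed.

(** Stepping from [v] to a neighbour one level lower until [rho] is reached gives a path with one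
    vertex on each level. *)
Lemma bfs_path D rho (lev : T -> nat) : rho \in D ->
    (forall v, v \in D -> v = rho \/
       exists u, [/\ u \in D, G u v & lev v = (lev u).+1]) ->
  forall v, v \in D -> exists Q : {set T},
    [/\ Q \subset D, connected_in G Q, v \in Q, rho \in Q
      & {in Q &, injective lev}] /\ forall u, u \in Q -> lev u <= lev v.
Proof.
move=> rD up v vD.
have [n] := ubnP (lev v); elim: n v vD => // n IH v vD lvn.
case: (up v vD) => [->|[u [uD Guv luv]]].
  exists [set rho]; split; last by move=> u /set1P->.
  split; rewrite ?inE ?sub1set //; first exact: connected1.
  by move=> a b /set1P-> /set1P->.
rewrite luv ltnS in lvn; case: (IH u uD lvn) => Q [[QD cQ uQ rQ inj] maxQ].
exists (Q :|: [set v]); split; last first.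
  by move=> a /setUP[/maxQ|/set1P-> //]; rewrite luv => /leqW.
split; rewrite ?subUset ?sub1set ?QD ?inE ?eqxx ?rQ ?orbT //.
  apply: connectedU => //; first exact: connected1.
  by apply/touchP; exists u, v; rewrite inE.
move=> a b /setUP[aQ|/set1P->] /setUP[bQ|/set1P->] // E; first exact: inj.
  by have := maxQ _ aQ; rewrite E luv ltnn.
by have := maxQ _ bQ; rewrite -E luv ltnn.
Qed.

(** [X] is the union of paths from the root [a ord0] to the [a i]; [p u] selects one path containing
    [u], on which the level determines the vertex. *)
Lemma bfs_tree D k (a : 'I_k.+1 -> T) :
    connected_in G D -> (forall i, a i \in D) ->
  exists (X : {set T}) (p : T -> 'I_k.+1) (lev : T -> nat),
    [/\ X \subset D, connected_in G X, forall i, a i \in X,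
        forall u v, u \in X -> v \in X -> p u = p v -> lev u = lev v -> u = v
      & forall u v, u \in D -> v \in D -> G u v -> lev v <= (lev u).+1].
Proof.
move=> cD aD; have [lev [_ lip up]] := bfs cD (aD ord0).
have [Q QP] := choice (fun i => bfs_path (aD ord0) up (aD i)).
exists (\bigcup_i Q i), (fun u => odflt ord0 [pick i | u \in Q i]), lev.
have QpP u : u \in \bigcup_i Q i -> u \in Q (odflt ord0 [pick i | u \in Q i]).
  by case/bigcupP=> i _ ui; case: pickP => //= /(_ i); rewrite ui.
split=> //.
- by apply/bigcupsP => i _; case: (QP i) => [[]].
- by apply: (@connected_bigcup _ _ (a ord0)) => i; case: (QP i) => [[]].
- by move=> i; apply/bigcupP; exists i => //; case: (QP i) => [[]].
- move=> u v /QpP uQ /QpP vQ /= E; rewrite E in uQ.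
  by case: (QP (odflt ord0 [pick i | v \in Q i])) => [[_ _ _ _ inj] _]; exact: inj.
Qed.

End Connectivity.

(** * Clusters made of paths and levels *)

Section Clusters.
Variables (T : finType) (G : sgraph T) (s : nat).
Implicit Types A B D H U X Y : {set T}.

(* [p] is the index of the path, increasing with the stages, whence the side
   condition on [p] in the last clause: a vertex of an earlier stage may have
   neighbours anywhere on the paths of the later stages. *)
Definition layered U H (n : nat) (p lev : T -> nat) : Prop :=
  [/\ H \subset U,
      forall v, v \in H -> p v < n * s.+1,
      forall u v, u \in H -> v \in H -> p u = p v -> lev u = lev v -> u = v,
      forall u v, u \in H -> v \in H -> p u = p v -> G u v ->
        odd (lev u) != odd (lev v)
    & forall v w w', v \in U -> w \in H -> w' \in H -> p w = p w' ->
        G v w -> G v w' -> (v \in H -> p w <= p v) -> lev w' <= (lev w).+2].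

(** The new paths are numbered from [n * s.+1] on, above all old ones. A vertex [v] with a neighbour
    on a new path that meets the side condition is therefore not in [H]; so it lies in the component
    [D], where an edge changes the level by at most one. *)
Lemma layered_extend U H n p lev D (a : 'I_s.+1 -> T) :
    layered U H n p lev -> D \subset U :\: H -> connected_in G D ->
    (forall y z, y \in D -> z \in U :\: H -> G y z -> z \in D) ->
    (forall i, a i \in D) ->
  exists X p' lev', [/\ X \subset D, connected_in G X, forall i, a i \in X
    & layered U (H :|: X) n.+1 p' lev'].
Proof.
move=> [HU pH inj par near] DU cD clD aD.
have [X [pX [lX [XD cX aX injX lipX]]]] := bfs_tree cD aD.
have DUH x : x \in D -> (x \in U) && (x \notin H).
  by move/(subsetP DU); rewrite inE andbC.
have XH x : x \in X -> x \notin H by move/(subsetP XD)/DUH/andP => [].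
have XinD x : x \in X -> x \in D by exact/subsetP.
have far v x : v \in H -> (n * s.+1 + x <= p v) = false.
  by move=> vH; rewrite leqNgt ltn_addr ?pH.
have farE v x : v \in H -> n * s.+1 + x <> p v.
  by move=> vH E; have := far v x vH; rewrite E leqnn.
exists X, (fun v => if v \in X then n * s.+1 + pX v else p v),
  (fun v => if v \in X then lX v else lev v).
split=> //; split.
- rewrite subUset HU; apply/subsetP => x /XinD /DUH /andP[]//.
- move=> v /setUP; case: ifP => [vX _|vX [vH|//]].
    by rewrite mulSn addnC ltn_add2r.
  by rewrite mulSn ltn_addl // pH.
- move=> u v /setUP uHX /setUP vHX.
  case: ifP uHX => uX uHX; case: ifP vHX => vX vHX.
  + by move/addnI/val_inj => E; exact: injX.
  + by case: vHX => // vH /(farE _ _ vH).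
  + by case: uHX => // uH /esym /(farE _ _ uH).
  + by case: uHX => // uH; case: vHX => // vH; exact: inj.
- move=> u v /setUP uHX /setUP vHX.
  case: ifP uHX => uX uHX; case: ifP vHX => vX vHX.
  + move/addnI/val_inj => E Guv.
    have luv := lipX _ _ (XinD _ uX) (XinD _ vX) Guv.
    have Gvu : G v u by rewrite (adj_sym G).
    have lvu := lipX _ _ (XinD _ vX) (XinD _ uX) Gvu.
    have : lX u <> lX v.
      by move/(injX _ _ uX vX E) => uv; rewrite uv (adj_irr G) in Guv.
    by clear -luv lvu; lia.
  + by case: vHX => // vH /(farE _ _ vH).
  + by case: uHX => // uH /esym /(farE _ _ uH).
  + by case: uHX => // uH; case: vHX => // vH; exact: par.
- move=> v w w' vU /setUP wHX /setUP wHX'.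
  case: ifP wHX => wX wHX; case: ifP wHX' => wX' wHX'.
  + move=> /addnI/val_inj E Gvw Gvw' vp.
    have vD : v \in D.
      apply: (clD w); rewrite ?XinD // ?inE ?vU ?andbT; last by rewrite (adj_sym G).
      apply/negP => vH; move: vp; rewrite inE vH => /(_ isT).
      by case: ifP => [/XH|_]; rewrite ?vH ?far.
    have Gwv : G w v by rewrite (adj_sym G).
    have := lipX _ _ (XinD _ wX) vD Gwv.
    by have := lipX _ _ vD (XinD _ wX') Gvw'; clear; lia.
  + by case: wHX' => // wH' /(farE _ _ wH').
  + by case: wHX => // wH /esym /(farE _ _ wH).
  + case: wHX => // wH; case: wHX' => // wH' E Gvw Gvw' vp.
    apply: (near v) => // vH; move: vp; rewrite inE vH => /(_ isT).
    by case: ifP => // /XH; rewrite vH.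
Qed.

(** * Stages of a cluster as branch sets of a minor *)

Section Packing.
Variables (t : nat) (J : 'I_s.+1 -> {set T}) (c0 : 'I_s.+1) (U : {set T}).
Hypothesis s_gt0 : 0 < s.
Hypothesis noK : ~ minor (Kstar s t) G.
Hypothesis conJ : forall c, connected_in G (J c).
Hypothesis disJ : forall c d, c != d -> [disjoint J c & J d].
Hypothesis touJ : forall c d, c != d -> J c != set0 -> J d != set0 ->
  touch G (J c) (J d).
Hypothesis disU : forall c, [disjoint J c & U].
Hypothesis conU : connected_in G U.

Definition packing H n : Prop := exists X : nat -> {set T},
  [/\ forall i, i < n -> X i \subset H,
      forall i, i < n -> connected_in G (X i),
      forall i j, i < n -> j < n -> i != j -> [disjoint X i & X j]
    & forall i c, i < n -> c != c0 -> touch G (J c) U -> touch G (J c) (X i)].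

(** Otherwise the [s] clusters of colour other than [c0], enumerated by [lift c0], form the clique
    side of a [Kstar s t] minor, and the [t] stages form its independent side. *)
Lemma packing_lt H n : H \subset U -> packing H n ->
  (forall c, c != c0 -> touch G (J c) U) -> n != t.
Proof.
move=> HU [X [XH cX dX tX]] tU; apply/eqP => nt; apply: noK.
have liftE i : lift c0 i != c0 by rewrite eq_sym neq_lift.
have JX i (j : 'I_t) : touch G (J (lift c0 i)) (X j).
  by apply: tX; rewrite ?nt ?tU.
have Jn0 i : J (lift c0 i) != set0 by apply: (@touch_neq0 _ G U); rewrite touchC tU.
have dJX i (j : 'I_t) : [disjoint J (lift c0 i) & X j].
  by apply: disjointWr (disU _); apply: subset_trans HU; apply: XH; rewrite nt.
exists (fun x => match x with inl i => J (lift c0 i) | inr j => X (nat_of_ord j) end).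
split.
(* A stage is nonempty because it touches a clique branch set, and there is one as [0 < s]. *)
- case=> [i|j] /=; [exact: Jn0 | exact: touch_neq0 (JX (Ordinal s_gt0) j)].
- case=> [i|j]; first exact: conJ.
  by apply: cX; rewrite nt.
- case=> [i|j] [i'|j'] ne //.
  + by apply: disJ; apply: contraNneq ne => /lift_inj->.
  + by rewrite disjoint_sym.
  + by apply: dX; rewrite ?nt.
- case=> [i|j] [i'|j'] //= ne; apply/touchP => //.
  + by apply: touJ => //; apply: contraNneq ne => /lift_inj->.
  + by rewrite touchC.
Qed.

Lemma packing_extend H n p lev D :
    layered U H n p lev -> packing H n -> connected_in G H ->
    D \subset U :\: H -> D != set0 -> connected_in G D ->
    (forall y z, y \in D -> z \in U :\: H -> G y z -> z \in D) ->
    (forall c, c != c0 -> touch G (J c) U -> touch G (J c) D) ->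
    H = set0 \/ touch G H D ->
  exists H' p' lev', [/\ layered U H' n.+1 p' lev', packing H' n.+1,
    connected_in G H', H' != set0
    & forall c, c != c0 -> touch G (J c) U -> touch G (J c) H'].
Proof.
move=> lay [X [XH cX dX tX]] cH DU D0 cD clD tD tHD.
(* [c0] is a free colour, so that its path can be used to reach [H]. *)
pose B c := if c == c0 then H else J c.
(* [a c] is a vertex of [D] next to [B c] if there is one, and any vertex of [D] otherwise. *)
have /choice[a aP] c : exists x, x \in D /\
    (touch G (B c) D -> touch G (B c) [set x]).
  case: (boolP (touch G (B c) D)) => [/touchP[y [x [yB xD Gyx]]]|_].
    by exists x; split=> // _; apply/touchP; exists y, x; rewrite inE.
  by have /set0Pn[x xD] := D0; exists x.
have [Z [p' [lev' [ZD cZ aZ lay']]]] := layered_extend lay DU cD clD (fun i => (aP i).1).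
have ZH : [disjoint H & Z].
  rewrite disjoint_sym; apply: disjointWl (subset_trans ZD DU) _.
  by rewrite -setI_eq0 setIDAC -setIDA setDv setI0.
have tZ c : touch G (B c) D -> touch G (B c) Z.
  by move/(aP c).2; apply: touchS; rewrite sub1set.
have tJZ c : c != c0 -> touch G (J c) U -> touch G (J c) Z.
  by move=> cc0 /(tD c cc0); have := tZ c; rewrite /B (negPf cc0).
exists (H :|: Z), p', lev'; split=> //.
- exists (fun i => if i == n then Z else X i); split.
  + move=> i; case: eqP => [_ _|/eqP ne]; first exact: subsetUr.
    by rewrite ltnS leq_eqVlt (negPf ne) => /XH XiH; apply: subset_trans XiH (subsetUl _ _).
  + move=> i; case: eqP => [//|/eqP ne].
    by rewrite ltnS leq_eqVlt (negPf ne) => /cX.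
  + move=> i j; rewrite !ltnS [i <= n]leq_eqVlt [j <= n]leq_eqVlt.
    case: (eqVneq i n) => [->|ni] /=; case: (eqVneq j n) => [->|nj] //=.
    * by move=> _ /XH /disjointWl d _; rewrite disjoint_sym d.
    * by move=> /XH /disjointWl d _ _; rewrite d.
    * exact: dX.
  + move=> i c; case: (eqVneq i n) => [_ _|ne]; first exact: tJZ.
    by rewrite ltnS leq_eqVlt (negPf ne) => /tX; apply.
- case: tHD => [->|tHD]; first by rewrite set0U.
  by apply: connectedU => //; have := tZ c0; rewrite /B eqxx; apply.
- by apply/set0Pn; exists (a c0); rewrite inE aZ orbT.
- by move=> c cc0 /(tJZ _ cc0); apply: touchS; exact: subsetUr.
Qed.

(** Stages are added as long as some connected part of [U :\: H] touches all clusters of colour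
    other than [c0]. By [packing_lt] their number never reaches [t], whence the induction on
    [t - n]. *)
Lemma cluster_exists : 1 < t -> U != set0 -> exists n H p lev,
  [/\ n < t, layered U H n p lev, connected_in G H, H != set0
    & (forall c, c != c0 -> touch G (J c) U -> touch G (J c) H) /\
      (forall Y, Y \subset U :\: H -> connected_in G Y ->
         exists2 c, c != c0 & ~~ touch G (J c) Y)].
Proof.
move=> t_gt1 U0.
have lay0 : layered U set0 0 (fun=> 0) (fun=> 0).
  by split=> [|v|u v|u v|v w w']; rewrite ?sub0set ?inE.
have pack0 : packing set0 0 by exists (fun=> set0).
(* The first stage is grown in [U] itself, where there is no [H] to reach yet. *)
have [||||H [p [lev [lay pack cH H0 tH]]]] := packing_extend lay0 pack0 (connected0 G) _ U0 conU.
- by rewrite setD0.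
- by move=> y z _; rewrite setD0.
- by [].
- by left.
have [m] := ubnP (t - 1); move: (1) t_gt1 lay pack => n n_lt.
elim: m n n_lt H p lev cH H0 tH => // m IH n n_lt H p lev cH H0 tH lay pack tnm.
have HU : H \subset U by case: lay.
have [[Y [YU cY tY]]|nY] := EM (exists Y, [/\ Y \subset U :\: H,
    connected_in G Y & forall c, c != c0 -> touch G (J c) Y]); last first.
  exists n, H, p, lev; split=> //; split=> // Y YU cY.
  apply: contrapT => nc; apply: nY; exists Y; split=> // c cc0.
  by apply: contraT => ntc; case: nc; exists c.
have tYU c : c != c0 -> touch G (J c) U.
  by move/tY; apply: touchS; apply: subset_trans YU (subsetDl _ _).
have /set0Pn[y yY] : Y != set0.
  by apply: (touch_neq0 (tY (lift c0 (Ordinal s_gt0)) _)); rewrite eq_sym neq_lift.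
have yUH := subsetP YU y yY.
have [D [[DU yD cD maxD] clD]] := component G yUH.
have YD := maxD _ YU cY yY.
(* As [U] is connected and meets [H] outside [D], some edge of [U] leaves [D]; since [D] is closed
   in [U :\: H], that edge ends in [H]. *)
have tHD : touch G H D.
  have /set0Pn[x xH] := H0.
  have DUU := subset_trans DU (subsetDl U H).
  have xD : x \notin D by apply: contraL xH => /(subsetP DU); rewrite inE => /andP[].
  have [d [z [dD zU zD Gdz]]] := connected_leave conU DUU yD (subsetP HU x xH) xD.
  rewrite touchC; apply/touchP; exists d, z; split=> //.
  by apply: contraNT zD => zH; apply: (clD d); rewrite // inE zH.
have [|||H' [p' [lev' [lay' pack' cH' H0' tH']]]] :=
  packing_extend lay pack cH DU _ cD clD.
- by apply/set0Pn; exists y.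
- by move=> c cc0 _; apply: touchS YD (tY c cc0).
- by right.
have HU' : H' \subset U by case: lay'.
apply: (IH n.+1 _ H' p' lev') => //; last by clear -tnm n_lt; lia.
by rewrite ltn_neqAle n_lt andbT; apply: packing_lt HU' pack' tYU.
Qed.

End Packing.

(** * Layouts of vertex sets, and the recursion over clusters *)

Section Layout.
Variables (t P : nat).
Local Notation color := 'I_s.+1.
Local Notation class := (color * 'I_P * bool)%type.

(* The second clause is what makes [early] survive the removal of a cluster:
   the neighbours of [v] in the class of [u] are never in an earlier cluster. *)
Definition early (J : color -> {set T}) U (cls : T -> class) q u v : Prop :=
  separated G cls q U u v /\ forall w, w \in J (cls u).1.1 -> ~~ G v w.

(** Relative to [U], these are the hypotheses of [boxicity_classes]; the second clause lets a vertex
    take a colour only if it has no neighbour in the kept cluster of that colour. *)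
Definition layout (J : color -> {set T}) U : Prop :=
  exists (cls : T -> class) (q : bool -> T -> nat) (l r : T -> nat),
  [/\ forall u, l u <= r u,
      forall u w, u \in U -> w \in J (cls u).1.1 -> ~~ G u w,
      forall u v, u \in U -> v \in U -> G u v ->
        cls u <> cls v /\ overlap l r u v,
      forall u v, u \in U -> v \in U -> u != v -> ~~ G u v ->
        overlap l r u v -> cls u = cls v -> q true u <> q true v
    & forall u v, u \in U -> v \in U -> u != v -> ~~ G u v ->
        overlap l r u v -> early J U cls q u v \/ early J U cls q v u].

Lemma layout0 J : 0 < P -> layout J set0.
Proof.
move=> P0.
exists (fun=> (ord0, Ordinal P0, true)), (fun _ _ => 0), (fun=> 0), (fun=> 0).
by split=> [//|u w|u v|u v|u v]; rewrite inE.
Qed.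

(** The two parts can share classes since no edge joins them; moving the intervals of [B] to the
    right of those of [A] separates all pairs across. *)
Lemma layout_disjoint J A B : (forall x y, x \in A -> y \in B -> ~~ G x y) ->
  [disjoint A & B] -> layout J A -> layout J B -> layout J (A :|: B).
Proof.
move=> AB dAB [c1 [q1 [l1 [r1 [lr1 cJ1 adj1 inj1 sep1]]]]].
move=> [c2 [q2 [l2 [r2 [lr2 cJ2 adj2 inj2 sep2]]]]].
pose N := (\max_u r1 u).+1.
have rN u : r1 u < N by rewrite ltnS; exact: leq_bigmax.
have nA u : u \in B -> (u \in A) = false.
  by move=> uB; apply/negP => uA; have := disjointFr dAB uA; rewrite uB.
have BA x y : x \in B -> y \in A -> ~~ G x y.
  by move=> xB yA; rewrite (adj_sym G) AB.
pose cls u := if u \in A then c1 u else c2 u.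
pose q b u := if u \in A then q1 b u else q2 b u.
pose l u := if u \in A then l1 u else N + l2 u.
pose r u := if u \in A then r1 u else N + r2 u.
have ovA u v : u \in A -> v \in A -> overlap l r u v = overlap l1 r1 u v.
  by move=> uA vA; rewrite /overlap /l /r uA vA.
have ovB u v : u \in B -> v \in B -> overlap l r u v = overlap l2 r2 u v.
  by move=> uB vB; rewrite /overlap /l /r !nA // !leq_add2l.
have ovAB u v : u \in A -> v \in B -> overlap l r u v = false.
  move=> uA vB; rewrite /overlap /l /r uA nA //; apply/negP => /andP[_].
  by have := rN u; clear; lia.
have earlyA u v : u \in A -> v \in A -> early J A c1 q1 u v ->
    early J (A :|: B) cls q u v.
  move=> uA vA [[b sb] cJ]; split; last by rewrite /cls uA.
  exists b => w /setUP[wA|wB] Gvw; last by rewrite (negPf (AB _ _ vA wB)) in Gvw.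
  by rewrite /cls /q uA wA; exact: sb.
have earlyB u v : u \in B -> v \in B -> early J B c2 q2 u v ->
    early J (A :|: B) cls q u v.
  move=> uB vB [[b sb] cJ]; split; last by rewrite /cls nA.
  exists b => w /setUP[wA|wB] Gvw; first by rewrite (negPf (BA _ _ vB wA)) in Gvw.
  by rewrite /cls /q !nA //; exact: sb.
exists cls, q, l, r; split.
- by move=> u; rewrite /l /r; case: ifP => // _; rewrite leq_add2l.
- move=> u w /setUP[uA|uB]; first by rewrite /cls uA; exact: cJ1.
  by rewrite /cls nA //; exact: cJ2.
- move=> u v /setUP[uA|uB] /setUP[vA|vB] Guv.
  + by rewrite ovA // /cls uA vA; exact: adj1.
  + by rewrite (negPf (AB _ _ uA vB)) in Guv.
  + by rewrite (negPf (BA _ _ uB vA)) in Guv.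
  + by rewrite ovB // /cls !nA //; exact: adj2.
- move=> u v /setUP[uA|uB] /setUP[vA|vB] uv nG.
  + by rewrite ovA // /cls /q uA vA; exact: inj1.
  + by rewrite ovAB.
  + by rewrite overlapC ovAB.
  + by rewrite ovB // /cls /q !nA //; exact: inj2.
- move=> u v /setUP[uA|uB] /setUP[vA|vB] uv nG.
  + rewrite ovA // => /(sep1 u v uA vA uv nG) [e|e]; [left|right]; exact: earlyA.
  + by rewrite ovAB.
  + by rewrite overlapC ovAB.
  + rewrite ovB // => /(sep2 u v uB vB uv nG) [e|e]; [left|right]; exact: earlyB.
Qed.

(** The vertices of [H] take colour [c0], precede the rest of [U] in both orders and get an interval
    meeting all intervals of the rest, so that the classes alone separate pairs involving [H]. *)
Lemma layout_cluster J J' c0 U H n p lev :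
    0 < P -> n * s.+1 <= P -> layered U H n p lev ->
    ~~ touch G (J c0) U -> J' c0 = H ->
    (forall c u w, c != c0 -> u \in U -> w \in J c -> G u w -> w \in J' c) ->
  layout J' (U :\: H) -> layout J U.
Proof.
move=> P0 nP [HU pH inj par near] tJ J'H J'J [c' [q' [l' [r' [lr' cJ' adj' inj' sep']]]]].
pose Nr := \max_u r' u.
have rN u : r' u <= Nr by exact: leq_bigmax.
pose Nq := (\max_u lev u).+1.
have lN u : lev u < Nq by rewrite ltnS; exact: leq_bigmax.
have UHP u : u \in U -> u \notin H -> u \in U :\: H by rewrite inE => -> ->.
(* The default of [insubd] never occurs, since [p u < n * s.+1 <= P] on [H]. *)
pose cls u := if u \in H then (c0, insubd (Ordinal P0) (p u), odd (lev u)) else c' u.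
pose q b u := if u \in H then (if b then lev u else Nq - lev u) else Nq.+1 + q' b u.
pose l u := if u \in H then 0 else l' u.
pose r u := if u \in H then Nr else r' u.
have clsH u v : u \in H -> v \in H -> cls u = cls v ->
    p u = p v /\ odd (lev u) = odd (lev v).
  move=> uH vH; rewrite /cls uH vH => -[/(congr1 val)].
  by rewrite !val_insubd !(leq_trans (pH _ _) nP).
have ovUH u v : u \notin H -> v \notin H -> overlap l r u v = overlap l' r' u v.
  by move=> /negPf uH /negPf vH; rewrite /overlap /l /r uH vH.
have nJ0 u w : u \in U -> w \in J c0 -> ~~ G u w.
  move=> uU wJ; apply: contra tJ => Guw.
  by apply/touchP; exists w, u; split; rewrite // (adj_sym G).
(* The old cluster of colour [c0] does not touch [U]; in any other colour, the neighbours of [U] in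
   [J c] survive in [J' c]. *)
have nJ u v w : u \in U :\: H -> v \in U :\: H ->
    (forall x, x \in J' (c' u).1.1 -> ~~ G v x) -> w \in J (c' u).1.1 -> ~~ G v w.
  move=> uUH /setDP[vU vH] nJ' wJ; have [E|ne] := eqVneq (c' u).1.1 c0.
    by apply: nJ0 => //; rewrite -E.
  by apply/negP => Gvw; have := nJ' w (J'J _ _ _ ne vU wJ Gvw); rewrite Gvw.
have cH u w : u \in U :\: H -> w \in H -> cls w = cls u -> w \in J' (c' u).1.1.
  move=> /setDP[uU /negPf uH] wH; rewrite /cls uH wH => <-.
  by rewrite /= J'H.
have earlyUH u v : u \in U :\: H -> v \in U :\: H ->
    early J' (U :\: H) c' q' u v -> early J U cls q u v.
  move=> uUH vUH [[b sb] cJ].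
  have /setDP[uU /negPf uH] := uUH; split; last first.
    by move=> w; rewrite /cls uH; exact: nJ.
  exists b => w wU Gvw cw; have [wH|wH] := boolP (w \in H).
    by have := cJ w (cH _ _ uUH wH cw); rewrite Gvw.
  move: cw; rewrite /cls /q uH (negPf wH) => cw.
  by rewrite ltn_add2l; apply: sb => //; exact: UHP.
have earlyH u v : u \in H -> v \in U -> ~~ G v u -> (v \in H -> p u <= p v) ->
    early J U cls q u v.
  move=> uH vU nG puv; split; last by move=> w; rewrite /cls uH; exact: nJ0.
  have lev_neq w : w \in H -> p w = p u -> G v w -> lev w <> lev u.
    by move=> wH pw Gvw lw; rewrite -(inj _ _ wH uH pw lw) Gvw in nG.
  (* If no neighbour [w] of [v] in the class has level at most that of [u], the plain order works.
     Otherwise equal parities and [lev w <> lev u] put [w] at least two levels below [u]. The other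
     neighbours of [v] in that path and class are at most two levels above [w] and not level with
     [u], hence below [u]: the reversed order works. *)
  have [[w [wH Gvw cw lwu]]|nw] := EM (exists w,
    [/\ w \in H, G v w, cls w = cls u & lev w <= lev u]); last first.
    exists true => w wU Gvw cw; rewrite /q uH; case: ifP => wH; last first.
      by have := lN u; clear; lia.
    by rewrite ltnNge; apply/negP => lwu; apply: nw; exists w.
  have [pw ow] := clsH _ _ wH uH cw; have lw := lev_neq w wH pw Gvw.
  exists false => w' wU Gvw' cw'; rewrite /q uH.
  case: ifP => wH'; last by have := lN u; clear; lia.
  have [pw' ow'] := clsH _ _ wH' uH cw'; have lw' := lev_neq w' wH' pw' Gvw'.
  have := near v w w' vU wH wH'; rewrite pw pw' => /(_ erefl Gvw Gvw' puv).
  by have := lN u; have := lN w'; clear -lw lw' ow ow' lwu; lia.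
have symG u v : G u v = G v u by exact: (adj_sym G).
exists cls, q, l, r; split.
- by move=> u; rewrite /l /r; case: ifP.
- move=> u w uU; rewrite /cls; case: ifP => uH; first exact: nJ0.
  by have uUH := UHP u uU (negbT uH); apply: nJ => // x; exact: cJ'.
- move=> u v uU vU Guv.
  have [uH|uH] := boolP (u \in H); have [vH|vH] := boolP (v \in H).
  + split; last by rewrite /overlap /l /r uH vH.
    move=> /(clsH _ _ uH vH) [pE oE].
    by have := par _ _ uH vH pE Guv; rewrite oE eqxx.
  + split; last by rewrite /overlap /l /r uH (negPf vH) (leq_trans (lr' v) (rN v)).
    move=> cE; have := cJ' v u (UHP _ vU vH) (cH _ _ (UHP _ vU vH) uH cE).
    by rewrite symG Guv.
  + split; last by rewrite /overlap /l /r vH (negPf uH) (leq_trans (lr' u) (rN u)).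
    move=> cE; have := cJ' u v (UHP _ uU uH) (cH _ _ (UHP _ uU uH) vH (esym cE)).
    by rewrite Guv.
  + by rewrite ovUH // /cls (negPf uH) (negPf vH); apply: adj'; rewrite ?UHP.
- move=> u v uU vU uv nG.
  have [uH|uH] := boolP (u \in H); have [vH|vH] := boolP (v \in H).
  + move=> _ /(clsH _ _ uH vH) [pE oE]; rewrite /q uH vH => lE.
    by rewrite (inj _ _ uH vH pE lE) eqxx in uv.
  + by move=> _ _; rewrite /q uH (negPf vH); have := lN u; clear; lia.
  + by move=> _ _; rewrite /q vH (negPf uH); have := lN v; clear; lia.
  + rewrite ovUH // /cls /q (negPf uH) (negPf vH) => ov cE.
    by move/addnI; apply: inj' => //; exact: UHP.
- move=> u v uU vU uv nG.
  have nG' : ~~ G v u by rewrite symG.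
  have [uH|uH] := boolP (u \in H); have [vH|vH] := boolP (v \in H).
  + by move=> _; have [le|/ltnW le] := leqP (p u) (p v); [left|right]; exact: earlyH.
  + by move=> _; left; apply: earlyH => //; rewrite (negPf vH).
  + by move=> _; right; apply: earlyH => //; rewrite (negPf uH).
  + rewrite ovUH // => ov; have uUH := UHP _ uU uH; have vUH := UHP _ vU vH.
    by case: (sep' _ _ uUH vUH uv nG ov) => e; [left|right]; exact: earlyUH.
Qed.

(* [J c] is the kept cluster of colour [c], or the empty set. *)
Definition context (J : color -> {set T}) U : Prop :=
  [/\ forall c, connected_in G (J c),
      forall c d, c != d -> [disjoint J c & J d],
      forall c d, c != d -> J c != set0 -> J d != set0 -> touch G (J c) (J d),
      forall c, [disjoint J c & U]
    & forall Y, Y \subset U -> connected_in G Y -> exists c, ~~ touch G (J c) Y].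

Lemma contextS J U U' : U' \subset U -> context J U -> context J U'.
Proof.
move=> U'U [cJ dJ tJ dU mJ]; split=> // [c|Y YU' cY].
  exact: disjointWr U'U (dU c).
by apply: mJ cY; exact: subset_trans U'U.
Qed.

(** Components are split off one at a time and joined by [layout_disjoint]. *)
Lemma layout_of_connected J U : 0 < P ->
  (forall D, D \subset U -> connected_in G D -> D != set0 -> layout J D) ->
  layout J U.
Proof.
move=> P0; have [m] := ubnP #|U|.
elim: m U => // m IH U; rewrite ltnS => Um layD.
have [->|/set0Pn[x xU]] := eqVneq U set0; first exact: layout0.
have [D [[DU xD cD _] clD]] := component G xU.
rewrite -(setID U D) (setIidPr DU); apply: layout_disjoint.
- move=> a b aD /setDP[bU bD]; apply: contra bD; exact: clD.
- by rewrite -setI_eq0 setIC setIDAC -setIDA setDv setI0.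
- by apply: layD cD _ => //; apply/set0Pn; exists x.
apply: IH => [|E EU]; last by apply: layD; exact: subset_trans EU (subsetDl _ _).
apply: leq_trans Um; apply: proper_card; rewrite properE subsetDl.
by apply/subsetPn; exists x => //; rewrite inE xD.
Qed.

(** Induction on the size of the set: the cluster of some colour [c0] misses the connected set [U],
    and a new cluster [H] takes that colour over. [P] counts [s.+1] paths in each of at most [t - 1]
    stages. *)
Lemma layout_exists J U : 0 < s -> 1 < t -> P = (t - 1) * s.+1 ->
  ~ minor (Kstar s t) G -> context J U -> layout J U.
Proof.
move=> s0 t1 PE noK; have [m] := ubnP #|U|.
have P0 : 0 < P by rewrite PE muln_gt0 subn_gt0 t1.
elim: m J U => // m IH J V; rewrite ltnS => Vm ctxV.
apply: layout_of_connected => // U UV cU U0.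
have ctx := contextS UV ctxV; have Um := leq_trans (subset_leq_card UV) Vm.
have [cJ dJ tJ dU mJ] := ctx.
have [c0 nt0] := mJ U (subxx _) cU.
have [n [H [p [lev [nt lay cH H0 [tH sepY]]]]]] :=
  cluster_exists c0 s0 noK cJ dJ tJ dU cU t1 U0.
have HU : H \subset U by case: lay.
(* Clusters that do not touch [U] are dropped, as only the others are known to touch [H]. *)
pose J' c := if c == c0 then H else if touch G (J c) U then J c else set0.
have J'P c : J' c = set0 \/ J' c = H /\ c = c0 \/
    [/\ J' c = J c, c != c0 & touch G (J c) U].
  rewrite /J'; have [->|ne] := eqVneq c c0; first by right; left.
  by case: ifP => t'; [right; right | left].
have dJH c : [disjoint J c & H] by exact: disjointWr HU (dU c).
apply: (layout_cluster (J' := J') (c0 := c0) P0 _ lay nt0).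
- by rewrite PE leq_mul2r; apply/orP; right; clear -nt; lia.
- by rewrite /J' eqxx.
- move=> c u w ne uU wJ Guw; rewrite /J' (negPf ne) ifT //.
  by apply/touchP; exists w, u; split; rewrite // (adj_sym G).
apply: IH.
  apply: leq_trans Um; apply: proper_card; rewrite properE subsetDl.
  have /set0Pn[h hH] := H0; apply/subsetPn.
  by exists h; [exact: (subsetP HU) | rewrite inE hH].
split.
- by move=> c; case: (J'P c) => [->|[[-> _]|[-> _ _]]] //; exact: connected0.
- move=> c d cd; case: (J'P c) => [->|[[-> ce]|[-> cc0 _]]].
  + by rewrite disjoints_subset sub0set.
  + case: (J'P d) => [->|[[_ de]|[-> _ _]]].
    * by rewrite disjoint_sym disjoints_subset sub0set.
    * by rewrite ce de eqxx in cd.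
    * by rewrite disjoint_sym.
  + case: (J'P d) => [->|[[-> de]|[-> _ _]]] //; last exact: dJ.
    by rewrite disjoint_sym disjoints_subset sub0set.
- move=> c d cd; case: (J'P c) => [->|[[-> ce]|[-> cc0 ct]]]; rewrite ?eqxx //.
  + case: (J'P d) => [->|[[_ de]|[-> dc0 dt]]]; rewrite ?eqxx //.
    * by rewrite ce de eqxx in cd.
    * by move=> _ _; rewrite touchC; exact: tH.
  + case: (J'P d) => [->|[[-> de]|[-> dc0 dt]]]; rewrite ?eqxx //.
    * by move=> _ _; exact: tH.
    * exact: tJ.
- move=> c; case: (J'P c) => [->|[[-> _]|[-> _ _]]].
  + by rewrite disjoints_subset sub0set.
  + by rewrite -setI_eq0 setIDA setDIl setDv set0I.
  + exact: disjointWr (subsetDl _ _) (dU c).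
- move=> Y YU cY; have [c cc0 tY] := sepY Y YU cY.
  exists c; case: (J'P c) => [->|[[_ ce]|[-> _ _]]] //.
    by apply/negP => /touchP[a [b []]]; rewrite inE.
  by rewrite ce eqxx in cc0.
Qed.

Lemma boxicity_layout (R : realType) J :
  layout J setT -> boxicity R G <= (s.+1 * P * 4).+1.
Proof.
move=> [cls [q [l [r [lr cJ adj inj sep]]]]].
have -> : s.+1 * P * 4 = #|{: class}| * 2.
  by rewrite !card_prod !card_ord card_bool -[RHS]mulnA.
apply: (@boxicity_classes R T G _ cls q l r) => //.
- by move=> u v; apply: adj; rewrite inE.
- by move=> u v; apply: inj; rewrite inE.
- move=> u v uv nG ov.
  by case: (sep u v _ _ uv nG ov) => [||[]|[]]; rewrite ?inE //; [left|right].
Qed.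

End Layout.
End Clusters.

(** * The case of one clique vertex *)

Section Star.
Variables (T : finType) (G : sgraph T) (t : nat).
Hypothesis t_gt1 : 1 < t.
Hypothesis noK : ~ minor (Kstar 1 t) G.

(** Otherwise contracting [B] gives the centre of a star with [t] leaves in [L]. *)
Lemma star_minor (B L : {set T}) : connected_in G B -> B != set0 ->
    [disjoint B & L] -> (forall v, v \in L -> touch G B [set v]) -> #|L| < t.
Proof.
move=> cB B0 dBL tBL; rewrite ltnNge; apply/negP => tL; apply: noK.
pose f (j : 'I_t) := enum_val (widen_ord tL j).
have fL j : f j \in L by exact: enum_valP.
have dBf j : [disjoint B & [set f j]].
  by apply: disjointWr dBL; rewrite sub1set.
exists (fun x => match x with inl _ => B | inr j => [set f j] end).
split.
- case=> [_|j] //; by apply/set0Pn; exists (f j); rewrite inE.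
- by case=> [_|j] //; exact: connected1.
- case=> [i|j] [i'|j'] ne //.
  + by rewrite !ord1 eqxx in ne.
  + by rewrite disjoint_sym.
  + rewrite disjoints1 inE; apply: contra ne => /eqP /enum_val_inj.
    by move/(congr1 val) => /= /val_inj ->.
- case=> [i|j] [i'|j'] //= ne; apply/touchP => //.
  + by rewrite !ord1 in ne.
  + exact: tBL.
  + by rewrite touchC; exact: tBL.
Qed.

(** Each level after the first consists of neighbours of the connected union of the earlier levels,
    so [star_minor] bounds its size. Taking the position in the level as path index makes [p] and
    [lev] determine the vertex. *)
Lemma layered_star (U : {set T}) : connected_in G U -> U != set0 ->
  exists p lev, layered G 0 U U (t - 1) p lev.
Proof.
move=> cU /set0Pn[rho rU]; have [lev [lev0 lip up]] := bfs cU rU.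
pose L v := [set u in U | lev u == lev v].
have Lt v : v \in U -> #|L v| < t.
  move=> vU; case E: (lev v) => [|n].
    (* Level zero contains [rho] only. *)
    apply: leq_ltn_trans t_gt1; rewrite -(cards1 rho); apply: subset_leq_card.
    by apply/subsetP => u; rewrite !inE E => /andP[/up [->|[w [_ _ ->]]]].
  pose B := [set u in U | lev u <= n].
  have rB : rho \in B by rewrite inE rU lev0.
  apply: (@star_minor B).
  - apply: (@connected_center _ _ _ rho) => y; rewrite inE => /andP[yU yn].
    have [Q [[QU cQ yQ rQ _] maxQ]] := bfs_path rU up yU.
    have QB : Q \subset B.
      apply/subsetP => u uQ; rewrite inE (subsetP QU) //=.
      exact: leq_trans (maxQ u uQ) yn.
    by apply: (induced_connectS QB); exact: cQ.
  - by apply/set0Pn; exists rho.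
  - rewrite -setI_eq0; apply/eqP/setP => u; rewrite !inE E.
    by case: (u \in U) => //=; case: eqP => [->|]; rewrite ?ltnn ?andbF.
  - move=> u; rewrite inE E => /andP[uU /eqP lu].
    case: (up u uU) => [ur|[w [wU Gwu lw]]]; first by rewrite ur lev0 in lu.
    apply/touchP; exists w, u; rewrite !inE wU; split=> //.
    by rewrite /= -ltnS -lw lu.
exists (fun v => index v (enum (L v))), lev.
have LL v : v \in U -> v \in enum (L v) by move=> vU; rewrite mem_enum inE vU /=.
have lvl u v : lev u = lev v -> L u = L v by move=> E; rewrite /L E.
have inj u v : u \in U -> v \in U -> index u (enum (L u)) = index v (enum (L v)) ->
    lev u = lev v -> u = v.
  move=> uU vU + E; rewrite (lvl _ _ E) => ie; rewrite -(nth_index u (LL v vU)) -ie.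
  by rewrite nth_index // -(lvl _ _ E) LL.
have symG u v : G u v = G v u by exact: (adj_sym G).
split=> //.
- move=> v vU; rewrite muln1 ltn_subRL add1n; apply: leq_trans (Lt v vU).
  by rewrite ltnS cardE index_mem LL.
- move=> u v uU vU pE Guv; have := lip _ _ uU vU Guv.
  have Gvu : G v u by rewrite symG.
  have := lip _ _ vU uU Gvu.
  have : lev u <> lev v.
    by move/(inj _ _ uU vU pE) => uv; rewrite uv (adj_irr G) in Guv.
  by clear; lia.
- move=> v w w' vU wU wU' _ Gvw Gvw' _.
  have Gwv : G w v by rewrite symG.
  by have := lip _ _ wU vU Gwv; have := lip _ _ vU wU' Gvw'; clear; lia.
Qed.

End Star.

Theorem theorem5 (R : realType) (s t : nat) (hs : 0 < s) (ht : 1 < t)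
    (T : finType) (G : sgraph T) (hG : ~ minor (Kstar s t) G) :
  boxicity R G <= 5 * s ^ 3 * (t - 1).
Proof.
have [s1|s_gt1] : s = 1 \/ 1 < s by lia.
  rewrite s1 in hG *; apply: leq_trans (_ : (1 * (t - 1) * 4).+1 <= _); last by lia.
  (* One colour is enough here, so the layout is used with [s] replaced by 0. *)
  apply: (@boxicity_layout _ G 0 _ R (fun=> set0)).
  apply: layout_of_connected => [|U _ cU U0]; first by lia.
  have [p [lev lay]] := layered_star ht hG cU U0.
  (* The whole component is one cluster, and the empty set remains. *)
  apply: (layout_cluster (J' := fun=> U) (c0 := ord0) _ _ lay) => //; try lia.
  - by apply/negP => /touchP[x [y []]]; rewrite inE.
  - by move=> c u w; rewrite ord1.
  - by rewrite setDv; apply: layout0; lia.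
apply: leq_trans (_ : (s.+1 * ((t - 1) * s.+1) * 4).+1 <= _).
  apply: (@boxicity_layout _ G s _ R (fun=> set0)).
  apply: (layout_exists hs ht erefl hG); split=> //.
  - by move=> c; exact: connected0.
  - by move=> c d _; rewrite disjoints_subset sub0set.
  - by move=> c d _; rewrite eqxx.
  - by move=> c; rewrite disjoints_subset sub0set.
  - move=> Y _ _; exists ord0.
    by apply/negP => /touchP[x [y []]]; rewrite inE.
have : 0 < t - 1 by lia.
move: (t - 1) => m; clear -s_gt1 => m0.
(* At [s = 2] this is [36 < 40]; at [s = 1] it fails. Strictness absorbs the one extra interval
   graph, as [0 < m]. *)
have : 4 * s.+1 ^ 2 < 5 * s ^ 3.
  by nia.
nia.
Qed.
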